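(* All finite semigroups admit straight-line programs of length $\mathcal{O}(\sqrt{N})$; that is, if $\mathbf{S}$ denotes the class of all finite semigroups, then $C^\infty_{\mathbf{S}}(N) \in \mathcal{O}(\sqrt{N})$.
   Context: Let $S$ be a finite semigroup and $\Sigma \subseteq S$. A straight-line program over $\Sigma$ is a finite sequence of instructions executed in order and operating on registers $r_1, r_2, \dots$ (arbitrarily many), each able to store one element of $S$. Each instruction is either $r_k \gets s$ for some $s \in \Sigma$, or $r_k \gets r_i \cdot r_j$, where $i,j,k$ need not be distinct and $r_i, r_j$ must have been assigned by previous instructions. Its length is the number of its instructions. It computes $t \in S$ if upon completion some register contains $t$. Let $c^\infty_S(t;\Sigma)$ denote the minimal length of a straight-line program over $\Sigma$ (with no restriction on the number of registers) computing $t$. Put $C^\infty_S = \max\{c^\infty_S(t;\Sigma) : \Sigma \subseteq S,\ t \in \langle \Sigma \rangle\}$, where $\langle\Sigma\rangle$ is the subsemigroup generated by $\Sigma$, and $C^\infty_{\mathbf{S}}(N) = \max\{C^\infty_S : S \text{ a finite semigroup}, |S| \leq N\}$. *)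

(* Defs.v *)
(* MathComp, with MathComp-Analysis for classical logic, the reals and
   Landau notation. *)
From HB Require Import structures.
From mathcomp Require Import all_boot boolp.

Set Implicit Arguments.
Unset Strict Implicit.
Unset Printing Implicit Defensive.

Local Open Scope group_scope.

#[short(type="finSemigroupType")]
HB.structure Definition FinSemigroup := {S of Semigroup S & Finite S}.

Section StraightLinePrograms.

Variable S : finSemigroupType.
Implicit Types (Sigma T : {set S}) (s t : S).

Definition generated_semigroup Sigma : {set S} :=
  \bigcap_(T : {set S} | (Sigma \subset T) && `[< mulg_closed T >]) T.

(* Registers are indexed by nat; [SetTo k s] is r_k <- s and [SetMul k i j] is
   r_k <- r_i * r_j. *)
Inductive instruction := SetTo of nat & S | SetMul of nat & nat & nat.

Definition program := seq instruction.

(* [None] marks a register that has not been assigned. *)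
Definition registers := nat -> option S.

Definition assign (r : registers) (k : nat) s : registers :=
  fun l => if l == k then Some s else r l.

(* [None] is returned when the instruction is not allowed: it loads an element
   outside Sigma, or reads a register that has not been assigned. *)
Definition step Sigma (r : registers) (c : instruction) : option registers :=
  match c with
  | SetTo k s => if s \in Sigma then Some (assign r k s) else None
  | SetMul k i j =>
      if (r i, r j) is (Some a, Some b) then Some (assign r k (a * b)) else None
  end.

Definition exec Sigma (P : program) : option registers :=
  foldl (fun o c => obind (fun r => step Sigma r c) o) (Some (fun=> None)) P.

Definition computes Sigma (P : program) t : Prop :=
  exists2 r : registers, exec Sigma P = Some r & exists k, r k = Some t.

Definition computable_in Sigma t : pred nat :=
  fun n => `[< exists2 P : program, size P = n & computes Sigma P t >].

(* The value 0 when no program over Sigma computes t is a junk value; by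
   [slp_exists] this does not happen when t is in <Sigma>. *)
Definition slp_cost t Sigma : nat :=
  if pselect (exists n, computable_in Sigma t n) is left ex_n
  then ex_minn ex_n else 0.

Definition semigroup_cost : nat :=
  \max_(Sigma : {set S}) \max_(t in generated_semigroup Sigma) slp_cost t Sigma.

Let listable Sigma (l : seq S) := exists P r,
  [/\ size P = size l, exec Sigma P = Some r & forall i, r i = onth l i].

Let listable_rcons Sigma l x : listable Sigma l ->
  x \in Sigma \/ (exists a b, [/\ a \in l, b \in l & x = a * b]) ->
  listable Sigma (rcons l x).
Proof.
move=> [P [r [szP eP rl]]] Hx.
have onthr i : assign r (size l) x i = onth (rcons l x) i.
  rewrite /assign; case: eqP => [->|/eqP neq].
    by rewrite onthE map_rcons nth_rcons size_map ltnn eqxx.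
  rewrite rl !onthE map_rcons nth_rcons size_map (negPf neq).
  by case: ltnP => // ?; rewrite nth_default ?size_map.
case: Hx => [xS|[a [b [al bl xab]]]].
  exists (rcons P (SetTo (size l) x)), (assign r (size l) x).
  split=> //; first by rewrite !size_rcons szP.
  by rewrite /exec foldl_rcons -/(exec Sigma P) eP /= xS.
exists (rcons P (SetMul (size l) (index a l) (index b l))), (assign r (size l) x).
split=> //; first by rewrite !size_rcons szP.
rewrite /exec foldl_rcons -/(exec Sigma P) eP /= !rl !onthE.
by rewrite !(nth_map a) ?index_mem // !nth_index // -xab.
Qed.

Lemma slp_exists Sigma t : t \in generated_semigroup Sigma ->
  exists2 n, computable_in Sigma t n & n <= #|S|.
Proof.
move=> tgen.
pose Q n := `[< exists l, [/\ uniq l, listable Sigma l & size l = n] >].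
have exQ : exists n, Q n.
  by exists 0; apply/asboolP; exists [::]; split=> //;
       exists [::], (fun=> None); split=> // i; rewrite onth0n.
have bdQ n : Q n -> n <= #|S|.
  by move=> /asboolP[l [/card_uniqP <- _ <-]]; apply: max_card.
case: (ex_maxnP exQ bdQ) => m /asboolP[l [ul Ql szl]] mmax.
have grow x : x \in Sigma \/ (exists a b, [/\ a \in l, b \in l & x = a * b]) ->
    x \in l.
  move=> Hx; apply/negPn/negP => xl.
  have /mmax : Q m.+1.
    apply/asboolP; exists (rcons l x); split.
    - by rewrite rcons_uniq xl.
    - exact: listable_rcons.
    - by rewrite size_rcons szl.
  by rewrite ltnn.
have tl : t \in l.
  move/bigcapP: tgen => /(_ [set x in l]); rewrite inE; apply.
  apply/andP; split.
    by apply/subsetP => x xS; rewrite inE; apply: grow; left.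
  apply/asboolP => x y; rewrite !inE => xl yl.
  by apply: grow; right; exists x, y.
exists m; last by apply: bdQ; apply/asboolP; exists l.
case: Ql => P [r [szP eP rl]].
apply/asboolP; exists P; first by rewrite szP.
exists r => //; exists (index t l).
by rewrite rl onthE (nth_map t) ?index_mem // nth_index.
Qed.

Lemma semigroup_cost_le_card : semigroup_cost <= #|S|.
Proof.
apply/bigmax_leqP => Sigma _; apply/bigmax_leqP => t tgen.
rewrite /slp_cost; case: pselect => // ex_n.
case: ex_minnP => m _ mmin.
by have [n /mmin mn] := slp_exists tgen; apply: leq_trans.
Qed.

End StraightLinePrograms.

Definition cost_attained (N m : nat) : bool :=
  `[< exists S : finSemigroupType, #|S| <= N /\ semigroup_cost S = m >].

(* The empty type is allowed as a semigroup, of cost 0; it only matters for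
   N = 0, where it makes the maximum below well defined. *)
Lemma cost_attained_ex N : exists m, cost_attained N m.
Proof.
have voidA : associative (fun x _ : void => x) by case.
pose V : finSemigroupType := HB.pack void (isSemigroup.Build void voidA).
exists (semigroup_cost V); apply/asboolP; exists V; split=> //.
by rewrite card_void.
Qed.

Lemma cost_attained_le N m : cost_attained N m -> m <= N.
Proof.
move=> /asboolP[S [leSN <-]].
exact: leq_trans (semigroup_cost_le_card S) leSN.
Qed.

Definition finite_semigroups_cost (N : nat) : nat :=
  ex_maxn (cost_attained_ex N) (@cost_attained_le N).

(* Main.v *)
From HB Require Import structures.
Require Import Defs.
From mathcomp Require Import all_boot all_order all_algebra.
From mathcomp Require Import boolp reals topology normedtype landau.
From mathcomp Require Import zify.
Import Order.TTheory GRing.Theory Num.Theory.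
Import numFieldNormedType.Exports.

(** Write the target t as the value of a word w over the generators that is
    minimal in the shortlex order. Two factors of w with the same value must
    then be the same word, since otherwise the smaller one could replace the
    larger one inside w. Hence the values tell the factors of w apart, and if
    p(k) is the number of distinct factors of length k, the sum of all p(k) is
    at most |S| + 1 (the extra one is for the empty word)
    ([reduced_word], [sum_complexity_le]). From here on the problem is one about
    words: if the sum of all p(k) is at most r^2, find a program of length O(r)
    for w.

    Let n be the length of w. For any length m, w can be computed from all its
    factors of length at most m, of which there are p(1) + ... + p(m), by
    multiplying n/m consecutive blocks ([computation_prefix]). If n is O(r), take
    m = 1. Otherwise take m = n/r, so that there are O(r) blocks, and it remains
    to see that p(1) + ... + p(m) is O(r). This holds because p is nondecreasing
    on the first half of its range: the values p(k) with k <= m are then at most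
    the average of p over a range of length proportional to n, that is O(r^2/n),
    and m times this is O(r) ([sum_complexity_head_le]).

    Monotonicity comes from a fact about arbitrary finite words: p(k) <= p(k+1)
    as soon as some factor of length k occurs twice ([complexity_leS]). If none
    did, the factors of length at least k would all be different,
    and there are about (n-k)^2/2 of these, which exceeds r^2 when n - k is at
    least 2r ([complexity_monotone]). *)

Local Open Scope nat_scope.

(** * Distinct factors of a finite word *)

Section Words.
Set Implicit Arguments.
Unset Strict Implicit.
Unset Printing Implicit Defensive.
Variable T : eqType.
Implicit Types (u v w : seq T) (i j k n r : nat).

Definition window k w i := take k (drop i w).

Definition windows k w := [seq window k w i | i <- iota 0 (size w - k).+1].

Definition factors k w := undup (windows k w).

Definition complexity w k := size (factors k w).

Lemma windowD k j w i : window (k + j) w i = window k w i ++ window j w (i + k).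
Proof. by rewrite /window takeD drop_drop [k + i]addnC. Qed.

Lemma take_windowS k w i : take k (window k.+1 w i) = window k w i.
Proof. by rewrite /window take_takel. Qed.

Lemma behead_windowS k w i : behead (window k.+1 w i) = window k w i.+1.
Proof. by rewrite /window -[i.+1]add1n -drop_drop drop1; case: (drop i w). Qed.

Lemma size_window k w i : i + k <= size w -> size (window k w i) = k.
Proof. by move=> ikn; rewrite size_takel // size_drop leq_subRL; lia. Qed.

Lemma factorsP k w u : k <= size w ->
  reflect (exists2 i, i + k <= size w & u = window k w i) (u \in factors k w).
Proof.
move=> kn; rewrite mem_undup.
apply: (iffP mapP) => -[i]; rewrite ?mem_iota => Hi ->; exists i => //.
  by lia.
by rewrite mem_iota; lia.
Qed.

Lemma size_factor k w u : k <= size w -> u \in factors k w -> size u = k.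
Proof. by move=> kn /(factorsP _ kn)[i ik ->]; apply: size_window. Qed.

Lemma infix_factor k w u : k <= size w -> u \in factors k w -> infix u w.
Proof.
move=> kn /(factorsP _ kn)[i _ ->].
exact: infix_trans (infix_take _ _) (infix_drop _ _).
Qed.

Lemma uniq_windowsP k w : k <= size w -> ~~ uniq (windows k w) ->
  exists i j, [/\ i < j, j + k <= size w & window k w i = window k w j].
Proof.
move=> kn; apply: contraNP => nex; rewrite map_inj_in_uniq ?iota_uniq // => i j.
rewrite !mem_iota => Hi Hj eij; case: (ltngtP i j) => // ij; case: nex.
- by exists i, j; split=> //; lia.
- by exists j, i; split=> //; lia.
Qed.

Lemma uniq_windowsS k w : uniq (windows k w) -> uniq (windows k.+1 w).
Proof.
move=> uk; apply: (@map_uniq _ _ (take k)); rewrite -map_comp.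
rewrite (eq_map (take_windowS k w)).
apply: subseq_uniq uk; apply: map_subseq.
have -> : (size w - k).+1 = (size w - k.+1).+1 + ((size w - k) - (size w - k.+1)) by lia.
by rewrite iotaD prefix_subseq.
Qed.

(** Deleting the last letter maps the factors of length k+1 onto the factors of
    length k, except that the suffix s of w of length k may be missed. Follow a
    repeated factor to the right for as long as its two occurrences agree. If
    the second occurrence reaches the end of w, then s occurs earlier too and is
    not missed. Otherwise the two occurrences are continued by different
    letters, so that two factors of length k+1 have the same image, which makes
    up for s. *)
Lemma complexity_repeat_le k w i j : i < j -> j + k <= size w ->
  window k w i = window k w j -> k < size w ->
  complexity w k <= complexity w k.+1.
Proof.
move=> + + + kn; have [d] := ubnP (size w - k - j).
elim: d i j => // d IH i j dj ij jn eij.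
pose s := window k w (size w - k).
have cover u : u \in factors k w ->
    u = s \/ exists2 v, v \in factors k.+1 w & u = take k v.
  case/(factorsP _ (ltnW kn))=> a an ->.
  have [eas|neas] := eqVneq a (size w - k); first by left; rewrite eas.
  right; exists (window k.+1 w a); last by rewrite take_windowS.
  by apply/(factorsP _ kn); exists a => //; lia.
have [jE|jlt] : j + k = size w \/ j + k < size w by lia.
  (* The repeated factor is the suffix: truncation is onto. *)
  rewrite /complexity -[leqRHS](size_map (take k)).
  apply: uniq_leq_size; first exact: undup_uniq.
  move=> u /cover[->|[v vB ->]]; apply/mapP; last by exists v.
  exists (window k.+1 w i); first by apply/(factorsP _ kn); exists i => //; lia.
  by rewrite take_windowS eij /s; congr window; lia.
have iB : window k.+1 w i \in factors k.+1 w.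
  by apply/(factorsP _ kn); exists i => //; lia.
have jB : window k.+1 w j \in factors k.+1 w.
  by apply/(factorsP _ kn); exists j => //; lia.
have [e1|ne1] := eqVneq (window k.+1 w i) (window k.+1 w j).
  by apply: (IH i.+1 j.+1); rewrite -?behead_windowS ?e1 //; lia.
(* The factor at i can be dropped from those of length k+1, as the one at j has
   the same truncation; the room gained is used for s. *)
have -> : complexity w k.+1 =
    size (s :: map (take k) (rem (window k.+1 w i) (factors k.+1 w))).
  by rewrite /= size_map size_rem // prednK // /complexity; case: factors iB.
apply: uniq_leq_size; first exact: undup_uniq.
move=> u /cover[->|[v vB ->]]; rewrite inE ?eqxx //; apply/orP; right.
apply/mapP; have [vi|vi] := eqVneq v (window k.+1 w i).
  exists (window k.+1 w j); last by rewrite vi !take_windowS.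
  by rewrite mem_rem_uniq ?undup_uniq // inE eq_sym ne1.
by exists v => //; rewrite mem_rem_uniq ?undup_uniq // inE vi.
Qed.

Lemma complexity_leS k w : k < size w -> ~~ uniq (windows k w) ->
  complexity w k <= complexity w k.+1.
Proof.
move=> kn /(uniq_windowsP (ltnW kn))[i [j [ij jn eij]]].
exact: complexity_repeat_le eij kn.
Qed.

Lemma complexity_uniq_windows k j w : uniq (windows k w) -> k <= j ->
  complexity w j = (size w - j).+1.
Proof.
move=> uk kj; have uj : uniq (windows j w).
  elim: j kj => [|j IH]; first by rewrite leqn0 => /eqP <-.
  by rewrite leq_eqVlt => /predU1P[<- //|/IH]; apply: uniq_windowsS.
by rewrite /complexity /factors undup_id // size_map size_iota.
Qed.

(** The form in which averages are taken below: a lower bound on a part of the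
    range bounds the whole sum. *)
Lemma leq_mul_sum (a b n c : nat) (F : nat -> nat) :
  b <= n -> (forall j, a <= j < b -> c <= F j) ->
  (b - a) * c <= \sum_(0 <= j < n) F j.
Proof.
move=> bn cF; have [ab|/ltnW ba] := leqP a b; last first.
  by rewrite (eqnP ba).
rewrite (@big_cat_nat _ _ _ a) ?(leq_trans ab) //= (@big_cat_nat _ _ _ b a) //=.
rewrite -sum_nat_const_nat addnCA (leq_trans _ (leq_addr _ _)) //.
by rewrite !big_seq; apply: leq_sum => j; rewrite mem_index_iota; apply: cF.
Qed.

(** If, for some k < j, no factor of length k occurred twice, then the same
    would hold for the lengths k, ..., k + r, and each of them has at least r
    occurrences of factors. These r + 1 lengths would contribute more than r^2
    to the sum. *)
Lemma complexity_monotone w r i j : 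
  \sum_(0 <= k < (size w).+1) complexity w k <= r ^ 2 ->
  0 < r -> i <= j -> j + 2 * r <= (size w).+2 ->
  complexity w i <= complexity w j.
Proof.
move=> sumr r0 ij; elim: j ij => [|j IH]; first by rewrite leqn0 => /eqP ->.
rewrite leq_eqVlt => /predU1P[-> //|ij jr].
apply: (leq_trans (IH _ _)) => //; first by lia.
apply: complexity_leS; first by lia.
apply/negP => /complexity_uniq_windows cj.
have : (j + r.+1 - j) * r <= r ^ 2.
  apply: leq_trans (sumr); apply: leq_mul_sum => [|k Hk]; first by lia.
  by rewrite cj; lia.
by rewrite addKn mulSn mulnn -[leqRHS]add0n leq_add2r leqn0; lia.
Qed.

(** As p is nondecreasing up to n/2, the sum on the left is at most l p(l), and
    p(l) is at most the average of p between l and n/2, a range of length at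
    least n/4 because l <= n/r <= n/4. *)
Lemma sum_complexity_head_le w r l : 0 < l ->
  \sum_(0 <= k < (size w).+1) complexity w k <= r ^ 2 ->
  4 <= r -> 4 * r <= size w -> l * r <= size w ->
  \sum_(1 <= k < l.+1) complexity w k <= 4 * r.
Proof.
move=> l0 sumr r4 rn ln; move nE: (size w) sumr rn ln => n sumr rn ln.
pose h := n./2; have hn : n <= h.*2.+1 by rewrite -[leqLHS]odd_double_half; lia.
have h2 : h.*2 <= n by rewrite -[leqRHS]odd_double_half; lia.
have l4 : 4 * l <= n by nia.
have cl : (h.+1 - l) * complexity w l <= r ^ 2.
  apply: leq_trans (sumr); apply: leq_mul_sum => [|k /andP[lk kh]]; first by lia.
  by apply: (@complexity_monotone w r); rewrite ?nE //; lia.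
have suml : \sum_(1 <= k < l.+1) complexity w k <= l * complexity w l.
  rewrite -[X in X * _](subn1 l.+1) -sum_nat_const_nat.
  rewrite !big_seq; apply: leq_sum => k; rewrite mem_index_iota => kl.
  by apply: (@complexity_monotone w r); rewrite ?nE //; lia.
have n0 : 0 < n by lia.
rewrite -(leq_pmul2r n0); apply: leq_trans (_ : 4 * r * (l * r) <= _); last by nia.
apply: leq_trans (_ : l * complexity w l * (4 * (h.+1 - l)) <= _).
  by apply: leq_mul => //; lia.
have -> : l * complexity w l * (4 * (h.+1 - l)) =
  4 * l * ((h.+1 - l) * complexity w l) by lia.
have -> : 4 * r * (l * r) = 4 * l * r ^ 2 by rewrite -mulnn; lia.
by rewrite leq_mul2l cl orbT.
Qed.

(** The sum counts the factors to be computed first, and the last term bounds the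
    number of blocks of length l to be multiplied afterwards. *)
Lemma exists_block_length w r : w != [::] ->
  \sum_(0 <= k < (size w).+1) complexity w k <= r ^ 2 -> 4 <= r ->
  exists l, [/\ 0 < l, l <= size w &
    \sum_(1 <= k < l.+1) complexity w k + (size w %/ l).+1 <= 9 * r].
Proof.
rewrite -size_eq0 -lt0n => n0 sumr r4.
have [nr|rn] := leqP (size w) (4 * r).
  exists 1; split=> //; rewrite big_nat1 divn1.
  have : complexity w 1 <= size w.
    rewrite (leq_trans (size_undup _)) // size_map size_iota.
    by lia.
  by lia.
have r0 : 0 < r by lia.
have l0 : 0 < size w %/ r by rewrite divn_gt0 //; lia.
have lr : size w %/ r * r <= size w by apply: leq_trunc_div.
have nl : size w < (size w %/ r).+1 * r by apply: ltn_ceil.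
exists (size w %/ r); split=> //; first by nia.
have s4 := sum_complexity_head_le l0 sumr r4 (ltnW rn) lr.
have : size w %/ (size w %/ r) <= 2 * r.
  by rewrite -ltnS ltn_divLR //; nia.
by lia.
Qed.

End Words.

(** * The shortlex order on words *)

Section ShortLex.
Set Implicit Arguments.
Unset Strict Implicit.
Unset Printing Implicit Defensive.
Variable T : finType.
Implicit Types (u v x y : seq T).

Local Notation base := (#|T|.+1).

(** The value of the word in base #|T|+1, the letters being the digits from 1 to
    #|T|. As the digit 0 is not used, a longer word has a larger value, and the
    order of the values is the shortlex order. Minimal words are thus obtained
    by minimizing a natural number. *)
Fixpoint code u : nat :=
  if u is a :: u' then (enum_rank a).+1 * base ^ size u' + code u' else 0.

Lemma code_cat u v : code (u ++ v) = code u * base ^ size v + code v.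
Proof.
elim: u => //= a u ->.
by rewrite size_cat expnD mulnDl addnA mulnA.
Qed.

Lemma code_lt u : code u < base ^ size u.
Proof.
elim: u => //= a u IH; have := ltn_ord (enum_rank a) => ra.
rewrite expnS; apply: leq_trans (_ : (enum_rank a).+2 * base ^ size u <= _).
  by rewrite [leqRHS]mulSn addnC ltn_add2r.
by rewrite leq_mul2r ltnS ra orbT.
Qed.

Lemma leq_size_code u v : code u <= code v -> size u <= size v.
Proof.
case: u => //= a u cuv; rewrite ltnNge; apply/negP => vu.
have := leq_ltn_trans cuv (code_lt v); rewrite ltnNge => /negP; apply.
rewrite (leq_trans (leq_pexp2l _ vu)) //.
by rewrite mulSn -addnA leq_addr.
Qed.

Lemma code_inj : injective code.
Proof.
move=> u v cuv.
have : size u = size v by apply/eqP; rewrite eqn_leq !leq_size_code ?cuv.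
elim: u v cuv => [|a u IH] [|b v] //= cab [suv].
have base_gt0 : 0 < base ^ size v by rewrite expn_gt0.
have qa : (enum_rank a).+1 = (enum_rank b).+1.
  move: (congr1 (divn^~ (base ^ size v)) cab).
  rewrite suv !divnMDl // !divn_small ?addn0 ?code_lt //.
  by rewrite -suv code_lt.
have -> : a = b by apply/enum_rank_inj/val_inj; case: qa.
by congr cons; apply: IH => //; move: cab; rewrite qa suv => /addnI.
Qed.

(** The shortlex order is compatible with concatenation on both sides, also when
    u and v differ in length. *)
Lemma code_infix_lt x u v y :
  code u < code v -> code (x ++ u ++ y) < code (x ++ v ++ y).
Proof.
move=> uv; have suv := leq_size_code (ltnW uv).
rewrite !code_cat -addnS; apply: leq_add.
  by rewrite leq_mul2l !size_cat leq_pexp2l ?orbT // leq_add2r.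
by rewrite -addSn leq_add2r ltn_mul2r uv expn_gt0.
Qed.

End ShortLex.

(** * Straight-line programs from words *)

Section Evaluation.
Set Implicit Arguments.
Unset Strict Implicit.
Unset Printing Implicit Defensive.
Variable S : finSemigroupType.
Implicit Types (Sigma : {set S}) (x y t : S) (u v w : seq S) (l : seq S).

(** S with an identity [None] adjoined, so that the empty word has a value and
    concatenation becomes multiplication without exception. *)
Definition omul (a b : option S) : option S :=
  match a, b with
  | Some x, Some y => Some (x * y)%g
  | None, _ => b
  | _, None => a
  end.

Lemma omulA : associative omul.
Proof. by case=> [x|] [y|] [z|] //=; rewrite mulgA. Qed.

Lemma omul0l : left_id None omul. Proof. by case. Qed.
Lemma omul0r : right_id None omul. Proof. by case. Qed.

HB.instance Definition _ :=
  Monoid.isLaw.Build (option S) None omul omulA omul0l omul0r.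

Definition eval w : option S := \big[omul/None]_(x <- w) Some x.

Lemma eval_cat u v : eval (u ++ v) = omul (eval u) (eval v).
Proof. exact: big_cat. Qed.

Lemma eval1 x : eval [:: x] = Some x.
Proof. exact: big_seq1. Qed.

Lemma generatedP Sigma t : t \in generated_semigroup Sigma ->
  exists2 w, {subset w <= Sigma} & eval w = Some t.
Proof.
pose P x := `[< exists2 w, {subset w <= Sigma} & eval w = Some x >].
move/bigcapP => /(_ [set x | P x]); rewrite inE.
suff H : (Sigma \subset [set x | P x]) && `[< mulg_closed [set x | P x] >].
  by move=> /(_ H)/asboolP.
apply/andP; split.
  apply/subsetP => x xS; rewrite inE; apply/asboolP.
  by exists [:: x]; [move=> y; rewrite inE => /eqP-> | exact: eval1].
apply/asboolP => x y; rewrite !inE => /asboolP[u uS ux] /asboolP[v vS vy].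
apply/asboolP; exists (u ++ v); last by rewrite eval_cat ux vy.
by move=> z; rewrite mem_cat => /orP[/uS|/vS].
Qed.

(** The word is a shortlex-minimal one for t: if two factors had the same value,
    replacing an occurrence of the larger by the smaller would give a smaller
    word for t. *)
Lemma reduced_word Sigma t : t \in generated_semigroup Sigma ->
  exists w, [/\ {subset w <= Sigma}, eval w = Some t &
    forall u v, infix u w -> infix v w -> eval u = eval v -> u = v].
Proof.
move=> /generatedP[w0 w0S w0t].
pose P n := `[< exists w, [/\ {subset w <= Sigma}, eval w = Some t & code w = n] >].
have exP : exists n, P n by exists (code w0); apply/asboolP; exists w0.
case: (ex_minnP exP) => _ /asboolP[w [wS wt <-]] wmin.
exists w; split=> //.
suff no_lt u v : infix u w -> infix v w -> eval u = eval v -> ~ code u < code v.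
  move=> u v uw vw euv; apply: code_inj.
  have [uv|vu|//] := ltngtP (code u) (code v).
    by case: (no_lt _ _ uw vw euv).
  by case: (no_lt _ _ vw uw (esym euv)).
move=> uw /infixP[x [y wE]] euv /(code_infix_lt x y); rewrite -wE.
apply/negP; rewrite -leqNgt; apply: wmin; apply/asboolP.
exists (x ++ u ++ y); split=> //; last by rewrite -wt wE !eval_cat euv.
move=> z; rewrite !mem_cat => /or3P[zx|/(mem_infix uw)/wS//|zy]; apply: wS.
  by rewrite wE mem_cat zx.
by rewrite wE !mem_cat zy !orbT.
Qed.

(** Evaluation is injective on the list of all distinct factors of w, the empty
    one included, and takes its values in the #|S|+1 elements of [option S]. *)
Lemma sum_complexity_le w :
  (forall u v, infix u w -> infix v w -> eval u = eval v -> u = v) ->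
  \sum_(0 <= k < (size w).+1) complexity w k <= #|S|.+1.
Proof.
move=> ev_inj.
pose fs m := flatten [seq factors k w | k <- index_iota 0 m].
have fsP m u : m <= (size w).+1 -> u \in fs m -> infix u w /\ size u < m.
  move=> mn /flattenP[s /mapP[k]]; rewrite mem_index_iota => /= km -> uk.
  have kn : k <= size w by lia.
  by split; [apply: infix_factor uk | rewrite (size_factor kn uk)].
have fsS m : fs m.+1 = fs m ++ factors m w.
  by rewrite /fs /index_iota !subn0 -addn1 iotaD map_cat flatten_cat /= cats0.
have fs_uniq m : m <= (size w).+1 -> uniq (fs m).
  elim: m => // m IH mn; rewrite fsS cat_uniq undup_uniq andbT IH ?(ltnW mn) //=.
  apply/hasPn => u um; apply/negP => /(fsP _ _ (ltnW mn))[_].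
  by rewrite (size_factor _ um) ?ltnn.
have -> : \sum_(0 <= k < (size w).+1) complexity w k = size (fs (size w).+1).
  by rewrite size_flatten /shape -map_comp sumnE big_map.
rewrite -card_option -(size_map eval); apply: leq_trans (max_card _).
apply: eq_leq; apply/esym/card_uniqP; rewrite map_inj_in_uniq ?fs_uniq //.
by move=> u v /fsP[//|uw _] /fsP[//|vw _]; apply: ev_inj.
Qed.

(** The straight-line programs in which no register is overwritten, given as the
    list of the computed elements, latest first; the number of elements is the
    length of the program. *)
Inductive computation Sigma : seq S -> Prop :=
| Computation0 : computation Sigma [::]
| ComputationGen x l : x \in Sigma -> computation Sigma l ->
    computation Sigma (x :: l)
| ComputationMul x y l : x \in l -> y \in l -> computation Sigma l ->
    computation Sigma ((x * y)%g :: l).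

(** The element computed after those of l goes to register [size l]; all registers
    in use have a smaller index, so nothing is lost. *)
Lemma computation_program Sigma l : computation Sigma l ->
  exists P r, [/\ size P = size l, exec Sigma P = Some r &
    forall x, x \in l -> exists2 k, k < size l & r k = Some x].
Proof.
have exec_rcons P c r : exec Sigma P = Some r ->
    exec Sigma (rcons P c) = step Sigma r c.
  by move=> eP; rewrite /exec foldl_rcons -/(exec Sigma P) eP.
have assignP r z l' : 
  (forall x, x \in l' -> exists2 k, k < size l' & r k = Some x) ->
  forall x, x \in z :: l' -> exists2 k, k < size (z :: l') &
     assign r (size l') z k = Some x.
  move=> rl x; rewrite inE => /predU1P[->|/rl[k kl rk]].
    by exists (size l') => //; rewrite /assign eqxx.
  by exists k; [apply: ltnW | rewrite /assign ltn_eqF].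
elim=> [|x l' xS _ [P [r [sP eP rl]]]|x y l' xl yl _ [P [r [sP eP rl]]]].
- by exists [::], (fun=> None).
- exists (rcons P (SetTo (size l') x)), (assign r (size l') x).
  by split; [rewrite size_rcons sP | rewrite (exec_rcons _ _ r) //= xS | exact: assignP].
- have [i _ ri] := rl _ xl; have [j _ rj] := rl _ yl.
  exists (rcons P (SetMul S (size l') i j)), (assign r (size l') (x * y)%g).
  split; [by rewrite size_rcons sP | | exact: assignP].
  by rewrite (exec_rcons _ _ r) //= ri rj.
Qed.

Lemma slp_cost_le Sigma l t : computation Sigma l -> t \in l ->
  slp_cost t Sigma <= size l.
Proof.
move=> /computation_program[P [r [sP eP rl]]] tl.
have cP : computable_in Sigma t (size l).
  apply/asboolP; exists P => //; exists r => //.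
  by have [k _ rk] := rl _ tl; exists k.
by rewrite /slp_cost; case: pselect => // ex_n; case: ex_minnP => m _; apply.
Qed.

Definition available l u := exists2 x, x \in l & eval u = Some x.

Lemma available_sub l1 l2 u :
  {subset l1 <= l2} -> available l1 u -> available l2 u.
Proof. by move=> l12 [x /l12 xl ux]; exists x. Qed.

(** Words that are each one step away from l are added at the cost of one
    instruction per word. *)
Lemma computation_cat Sigma l (us : seq (seq S)) : computation Sigma l ->
  (forall u, u \in us ->
     (exists2 x, x \in Sigma & u = [:: x]) \/
     (exists a b, [/\ available l a, available l b & u = a ++ b])) ->
  exists l', [/\ computation Sigma l', size l' = size us + size l,
    {subset l <= l'} & forall u, u \in us -> available l' u].
Proof.
move=> cl; elim: us => [|u us IH] Hus; first by exists l; split.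
have [v vus|l' [cl' sl' ll' usl']] := IH.
  by apply: Hus; rewrite inE vus orbT.
have [x [cx ux]] : exists x, computation Sigma (x :: l') /\ eval u = Some x.
  have [|[x xS ->]|[a [b [[x xl ax] [y yl bY] ->]]]] := Hus u.
  - by rewrite inE eqxx.
  - by exists x; split; [apply: ComputationGen | apply: eval1].
  - exists (x * y)%g; split; last by rewrite eval_cat ax bY.
    by apply: ComputationMul => //; apply: ll'.
exists (x :: l'); split=> //=; first by rewrite sl'.
  by move=> y /ll' yl; rewrite inE yl orbT.
move=> v; rewrite inE => /predU1P[->|/usl']; first by exists x; rewrite ?mem_head.
by apply: available_sub => y yl; rewrite inE yl orbT.
Qed.

(** A factor of length k+1 is a factor of length k followed by a single letter,
    so all short factors can be computed by increasing length, one instruction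
    for each. *)
Lemma computation_factors Sigma w m : {subset w <= Sigma} -> m <= size w ->
  exists l, [/\ computation Sigma l,
    size l = \sum_(1 <= k < m.+1) complexity w k &
    forall k u, 0 < k <= m -> u \in factors k w -> available l u].
Proof.
move=> wS; elim: m => [|m IH] mn.
  exists [::]; split; [exact: Computation0 | by rewrite big_geq | by case].
have [l [cl sl lP]] := IH (ltnW mn).
have [u uF|l' [cl' sl' ll' l'P]] := @computation_cat Sigma l (factors m.+1 w) cl.
  have /(factorsP _ mn)[i im uE] := uF.
  have im1 : i + m + 1 <= size w by rewrite -addnA addn1.
  have w1 : 0 < size w by apply: leq_trans mn.
  have [x xE] : exists x, window 1 w (i + m) = [:: x].
    by case: (window 1 w (i + m)) (size_window im1) => [//|x []// _]; exists x.
  have xF : [:: x] \in factors 1 w.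
    by apply/(factorsP _ w1); exists (i + m).
  have {}uE : u = window m w i ++ [:: x] by rewrite uE -addn1 windowD xE.
  have [m0|m0] := posnP m.
    left; exists x; last by rewrite uE m0 /window take0.
    by apply: wS; rewrite -infix1s (infix_factor w1 xF).
  right; exists (window m w i), [:: x]; split=> //.
    apply: (lP m); first by rewrite m0 leqnn.
    apply/(factorsP _ (ltnW mn)); exists i => //.
    by apply: leq_trans im; rewrite leq_add2l.
  by apply: (lP 1).
exists l'; split=> //; first by rewrite sl' sl [RHS]big_nat_recr //= addnC.
move=> k u /andP[k0]; rewrite leq_eqVlt ltnS => /predU1P[->|km]; first exact: l'P.
by move=> uF; apply: available_sub ll' _; apply: (lP k); rewrite ?k0.
Qed.

(** Once all factors of length at most m are available, the prefixes of w can be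
    lengthened by m letters with one multiplication. The minimum accounts for
    the last block, which may be shorter. *)
Lemma computation_prefix Sigma w m q : {subset w <= Sigma} ->
  0 < m <= size w -> q * m < size w ->
  exists l, [/\ computation Sigma l,
    size l = \sum_(1 <= k < m.+1) complexity w k + q,
    forall k u, 0 < k <= m -> u \in factors k w -> available l u &
    available l (take (minn (q.+1 * m) (size w)) w)].
Proof.
move=> wS /andP[m0 mn]; elim: q => [|q IH] qn.
  have [l [cl sl lP]] := computation_factors wS mn; exists l.
  split=> //; first by rewrite addn0.
  rewrite mul1n (minn_idPl mn); apply: (lP m); first by rewrite m0 leqnn.
  by apply/(factorsP _ mn); exists 0; rewrite // /window drop0.
have [l [cl sl lP lw]] := IH (leq_ltn_trans (leq_mul (leqnSn q) (leqnn m)) qn).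
rewrite (minn_idPl (ltnW qn)) in lw.
pose b := minn m (size w - q.+1 * m).
have bP : available l (window b w (q.+1 * m)).
  apply: (lP b); first by lia.
  have bn : q.+1 * m + b <= size w by rewrite -leq_subRL ?geq_minr // ltnW.
  apply/factorsP; last by exists (q.+1 * m).
  by apply: leq_trans bn; apply: leq_addl.
have [u uE|l' [cl' sl' ll' l'P]] := @computation_cat Sigma l
    [:: take (minn (q.+2 * m) (size w)) w] cl.
  right; exists (take (q.+1 * m) w), (window b w (q.+1 * m)); split=> //.
  move: uE; rewrite inE => /eqP ->; rewrite /window -takeD; congr (take _ w).
  by rewrite mulSn; lia.
exists l'; split.
- by [].
- by rewrite sl' sl addnS.
- by move=> k u Hk uF; apply: available_sub ll' _; apply: (lP k).
- by apply: l'P; rewrite mem_head.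
Qed.

Lemma semigroup_cost_sqrt r : #|S| < r ^ 2 -> 4 <= r ->
  semigroup_cost S <= 9 * r.
Proof.
move=> Sr r4; apply/bigmax_leqP => Sigma _; apply/bigmax_leqP => t.
move=> /reduced_word[w [wS wt ev_inj]].
have w0 : w != [::] by case: w wt {wS ev_inj} => //; rewrite /eval big_nil.
have sumr := leq_trans (sum_complexity_le ev_inj) Sr.
have [m [m0 mn cost]] := exists_block_length w0 sumr r4.
have n0 : 0 < size w by rewrite lt0n size_eq0.
have qn : (size w).-1 %/ m * m < size w.
  by rewrite -[ltnRHS](prednK n0) ltnS leq_trunc_div.
have m0n : 0 < m <= size w by rewrite m0.
have [l [cl sl _ [x xl]]] := computation_prefix wS m0n qn.
(* With q = (n-1)/m extensions the last block starts inside w and the prefix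
   reaches its end. *)
rewrite take_oversize => [|]; last first.
  by rewrite leq_min leqnn andbT -[leqLHS](prednK n0) ltn_ceil.
rewrite wt => -[tx]; rewrite -tx in xl.
apply: leq_trans (slp_cost_le cl xl) _; rewrite sl; apply: leq_trans cost.
by rewrite leq_add2l leqW // leq_div2r // leq_pred.
Qed.

End Evaluation.

(** * The asymptotic bound *)

Lemma finite_semigroups_cost_le N r : N < r ^ 2 -> 4 <= r ->
  finite_semigroups_cost N <= 9 * r.
Proof.
move=> Nr r4; rewrite /finite_semigroups_cost; case: ex_maxnP => m.
move=> /asboolP[S [SN <-]] _; apply: semigroup_cost_sqrt => //.
exact: leq_ltn_trans Nr.
Qed.

Local Open Scope ring_scope.
Local Open Scope classical_set_scope.

Theorem proposition2 (R : realType) :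
  (fun N : nat => (finite_semigroups_cost N)%:R : R)
    =O_\oo (fun N : nat => Num.sqrt (N%:R : R)).
Proof.
(* The least natural number above sqrt N, plus 3 to make it at least 4, is a
   possible r; it is at most sqrt N + 4, hence at most 5 sqrt N for N >= 1, and
   45 = 9 * 5. *)
apply/eqO_exP; exists 45%:R; first by rewrite ltr0n.
exists 1%N => // N /= N1.
rewrite ger0_norm ?ler0n // ger0_norm ?sqrtr_ge0 //.
set s := Num.sqrt N%:R.
have s1 : 1 <= s by rewrite -[leLHS]sqrtr1 ler_wsqrtr // ler1n.
pose r := (Num.truncn s + 4)%N.
have sr : s < r%:R.
  apply: lt_le_trans (truncnS_gt s) _.
  by rewrite ler_nat /r -addn1 leq_add2l.
have rs : r%:R <= 5%:R * s.
  rewrite /r natrD (natrD _ 1 4) mulrDl mul1r lerD //.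
    by rewrite truncn_le sqrtr_ge0.
  by rewrite ler_peMr // ler0n.
have Nr : (N < r ^ 2)%N.
  rewrite -(ltr_nat R) natrX -[ltLHS]sqr_sqrtr ?ler0n //.
  by rewrite ltrXn2r // sqrtr_ge0.
apply: le_trans (_ : (9 * r)%:R <= _).
  by rewrite ler_nat finite_semigroups_cost_le // /r leq_addl.
by rewrite natrM (natrM _ 9 5) -mulrA ler_wpM2l // ler0n.
Qed.
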